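(* Suppose that at iteration $k$ of Algorithm NeMO (described in the context) the coarse correction step $\hat{\mathbf{d}}_{h,k}$ is taken and the stepsize is $\alpha_{h,k}=1$. Let $\mathbf{x}_{h,\star}$ be the minimizer of $f_h$. Then $$\Vert\mathbf{x}_{h,k+1}-\mathbf{x}_{h,\star}\Vert\le\Vert\mathbf{I}-\mathbf{P}[\mathbf{R}\nabla^2 f_{h,k}\mathbf{P}]^{-1}\mathbf{R}\nabla^2 f_{h,k}\Vert\,\Vert(\mathbf{I}-\mathbf{P}\mathbf{R})(\mathbf{x}_{h,k}-\mathbf{x}_{h,\star})\Vert+\frac{M_h\omega^2\xi^2}{2\mu_h}\Vert\mathbf{x}_{h,k}-\mathbf{x}_{h,\star}\Vert^2.$$
   Context: $\Vert\cdot\Vert$ is the Euclidean norm for vectors and the induced (spectral) norm for matrices. Assumptions on $f_h$: $f_h:\mathbb{R}^N\to\mathbb{R}$ is twice differentiable and there are constants $\mu_h,L_h,M_h>0$ with $\mu_h\mathbf{I}\preccurlyeq\nabla^2 f_h(\mathbf{x})\preccurlyeq L_h\mathbf{I}$ for all $\mathbf{x}\in\mathbb{R}^N$ and $\Vert\nabla^2 f_h(\mathbf{x})-\nabla^2 f_h(\mathbf{y})\Vert\le M_h\Vert\mathbf{x}-\mathbf{y}\Vert$ for all $\mathbf{x},\mathbf{y}\in\mathbb{R}^N$. Operators: $n\le N$, $\mathbf{P}\in\mathbb{R}^{N\times n}$ has full column rank $n$, $\mathbf{R}=\mathbf{P}^T\in\mathbb{R}^{n\times N}$, $\omega=\max\{\Vert\mathbf{P}\Vert,\Vert\mathbf{R}\Vert\}$,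 $\mathbf{P}^+=(\mathbf{R}\mathbf{P})^{-1}\mathbf{R}$, $\xi=\Vert\mathbf{P}^+\Vert$. Algorithm NeMO. Parameters: $\kappa\in(0,\min(1,\Vert\mathbf{R}\Vert))$, $\epsilon\in(0,1)$, $\rho_1\in(0,0.5)$, $\beta_{ls}\in(0,1)$; starting point $\mathbf{x}_{h,0}\in\mathbb{R}^N$. Write $\nabla f_{h,k}=\nabla f_h(\mathbf{x}_{h,k})$, $\nabla^2 f_{h,k}=\nabla^2 f_h(\mathbf{x}_{h,k})$. For $k=0,1,2,\dots$: (1) If $\Vert\mathbf{R}\nabla f_{h,k}\Vert>\kappa\Vert\nabla f_{h,k}\Vert$ and $\Vert\mathbf{R}\nabla f_{h,k}\Vert>\epsilon$, take the coarse correction step $\mathbf{d}=\hat{\mathbf{d}}_{h,k}=-\mathbf{P}[\mathbf{R}\nabla^2 f_{h,k}\mathbf{P}]^{-1}\mathbf{R}\nabla f_{h,k}$. Otherwise take a fine correction step $\mathbf{d}=-\mathbf{Q}^{-1}\nabla f_{h,k}$ with $\mathbf{Q}\in\mathbb{R}^{N\times N}$ positive definite. (2) Find the smallest $q\in\{0,1,2,\dots\}$ such that $\alpha_{h,k}=\beta_{ls}^q$ satisfies $f_h(\mathbf{x}_{h,k}+\alpha_{h,k}\mathbf{d})\le f_h(\mathbf{x}_{h,k})+\rho_1\alpha_{h,k}\nabla f_{h,k}^T\mathbf{d}$. (3) Set $\mathbf{x}_{h,k+1}=\mathbf{x}_{h,k}+\alpha_{h,k}\mathbf{d}$. *)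

(* Defs.v *)
From HB Require Import structures.
From mathcomp Require Import all_boot all_order all_algebra.
From mathcomp Require Import all_classical all_reals all_analysis.

Set Implicit Arguments.
Unset Strict Implicit.
Unset Printing Implicit Defensive.

Import Order.TTheory GRing.Theory Num.Theory.
Import numFieldNormedType.Exports.

Local Open Scope classical_set_scope.
Local Open Scope ring_scope.

Section Euclidean.
Context {R : realType}.

Definition dotcv {m : nat} (u v : 'cV[R]_m) : R := \sum_(i < m) u i 0 * v i 0.

(* The norm `|v| that the library puts on matrices is the max norm; it serves
   here only for its topology, which does not depend on the choice of norm. *)
Definition enorm {m : nat} (v : 'cV[R]_m) : R := Num.sqrt (dotcv v v).

Definition specnorm {m p : nat} (A : 'M[R]_(m, p)) : R :=
  sup [set enorm (A *m v) | v in [set v : 'cV[R]_p | enorm v <= 1]].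

(* Symmetry is not part of these two notions. Below, loewner_le only compares
   Hessians of twice differentiable functions with multiples of the identity,
   and all of these are symmetric. For posdefmx, dropping symmetry only
   enlarges the choice of Q in the fine steps of the algorithm. *)
Definition loewner_le {m : nat} (A B : 'M[R]_m) : Prop :=
  forall v : 'cV[R]_m, 0 <= dotcv v ((B - A) *m v).

Definition posdefmx {m : nat} (A : 'M[R]_m) : Prop :=
  forall v : 'cV[R]_m, v != 0 -> 0 < dotcv v (A *m v).

End Euclidean.

Section Calculus.
Context {R : realType} {N : nat}.
Implicit Types (f : 'cV[R]_N -> R) (x : 'cV[R]_N).

Definition gradient f x : 'cV[R]_N :=
  \col_(i < N) 'D_(delta_mx i 0 : 'cV[R]_N) f x.

Definition hessian f x : 'M[R]_N :=
  \matrix_(i < N, j < N)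
    'D_(delta_mx j 0 : 'cV[R]_N) (fun y => gradient f y i 0) x.

Definition twice_differentiable f : Prop :=
  (forall x, differentiable f x) /\ (forall x, differentiable (gradient f) x).

Definition minimizer f x : Prop := forall y, f x <= f y.

End Calculus.

Section NeMO.
Context {R : realType} {N n : nat}.
Variables (f : 'cV[R]_N -> R) (P : 'M[R]_(N, n)) (Rs : 'M[R]_(n, N)).
Variables (kappa eps rho1 beta : R).
Implicit Types (x d : 'cV[R]_N) (alpha : R).

Definition coarse_pinv : 'M[R]_(n, N) := invmx (Rs *m P) *m Rs.

Definition coarse_hessian x : 'M[R]_n := Rs *m hessian f x *m P.

Definition coarse_step x : 'cV[R]_N :=
  - (P *m invmx (coarse_hessian x) *m Rs *m gradient f x).

Definition coarse_condition x : Prop :=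
  enorm (Rs *m gradient f x) > kappa * enorm (gradient f x) /\
  enorm (Rs *m gradient f x) > eps.

(* The matrix Q of a fine step may change from one iteration to the next. *)
Definition nemo_direction x d : Prop :=
  (coarse_condition x /\ d = coarse_step x) \/
  (~ coarse_condition x /\
   exists2 Q : 'M[R]_N, posdefmx Q & d = - (invmx Q *m gradient f x)).

Definition sufficient_decrease x d alpha : Prop :=
  f (x + alpha *: d) <= f x + rho1 * alpha * dotcv (gradient f x) d.

Definition line_search x d alpha : Prop :=
  exists q : nat,
    [/\ alpha = beta ^+ q,
        sufficient_decrease x d (beta ^+ q) &
        forall r : nat, (r < q)%N -> ~ sufficient_decrease x d (beta ^+ r)].

Definition nemo_run (x d : nat -> 'cV[R]_N) (alpha : nat -> R) : Prop :=
  forall k : nat,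
    [/\ nemo_direction (x k) (d k),
        line_search (x k) (d k) (alpha k) &
        x k.+1 = x k + alpha k *: d k].

End NeMO.

(* Main.v *)
Require Import Defs.
From HB Require Import structures.
From mathcomp Require Import all_boot all_order all_algebra.
From mathcomp Require Import all_classical all_reals all_analysis.
From mathcomp Require Import ring lra.

(* Write e = x_k - xstar, H for the Hessian and g for the gradient of f at x_k,
   and C = P (R H P)^-1 R. Then x_{k+1} - xstar = (1 - C H) e + C (H e - g).
   Since (1 - C H) P = 0, e may be replaced by (1 - P R) e in the first term.
   In the second, the gradient vanishes at xstar, so H e - g is its first-order
   Taylor remainder, bounded by M/2 |e|^2: apply the mean value theorem along
   the segment to the scalar product of the gradient with the remainder itself.
   Finally |C| <= omega^2 xi^2 / mu, because |u| = |P^+ P u| <= xi |P u| gives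
   mu |u|^2 <= xi^2 <u, R H P u>. *)

Set Implicit Arguments.
Unset Strict Implicit.
Unset Printing Implicit Defensive.

Import Order.TTheory GRing.Theory Num.Theory.
Import numFieldNormedType.Exports.

Local Open Scope ring_scope.

(** * Cauchy-Schwarz, the Euclidean norm and the spectral norm *)

Section EuclideanNorm.
Context {R : realType}.

Lemma dotcvE m (u v : 'cV[R]_m) : dotcv u v = (u^T *m v) 0 0.
Proof. by rewrite /dotcv mxE; apply: eq_bigr => i _; rewrite mxE. Qed.

Lemma dotcvC m (u v : 'cV[R]_m) : dotcv u v = dotcv v u.
Proof. by apply: eq_bigr => i _; rewrite mulrC. Qed.

Lemma dotcvDr m (u v w : 'cV[R]_m) : dotcv u (v + w) = dotcv u v + dotcv u w.
Proof. by rewrite !dotcvE mulmxDr mxE. Qed.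

Lemma dotcvBr m (u v w : 'cV[R]_m) : dotcv u (v - w) = dotcv u v - dotcv u w.
Proof. by rewrite !dotcvE mulmxBr !mxE. Qed.

Lemma dotcvZr m a (u v : 'cV[R]_m) : dotcv u (a *: v) = a * dotcv u v.
Proof. by rewrite !dotcvE -scalemxAr mxE. Qed.

Lemma dotcv_trmx m p (A : 'M[R]_(m, p)) (u : 'cV_m) (v : 'cV_p) :
  dotcv u (A *m v) = dotcv (A^T *m u) v.
Proof. by rewrite !dotcvE trmx_mul trmxK mulmxA. Qed.

Lemma dotcv_ge0 m (u : 'cV[R]_m) : 0 <= dotcv u u.
Proof. by apply: sumr_ge0 => i _; rewrite -expr2 sqr_ge0. Qed.

Lemma dotcv_eq0 m (u : 'cV[R]_m) : dotcv u u = 0 -> u = 0.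
Proof.
move=> u0; apply/matrixP => i j; rewrite ord1 mxE; apply/eqP.
rewrite -sqrf_eq0 expr2; apply/eqP.
by apply: (psumr_eq0P _ u0) => // {}i _; rewrite -expr2 sqr_ge0.
Qed.

Lemma enorm_ge0 m (u : 'cV[R]_m) : 0 <= enorm u.
Proof. exact: sqrtr_ge0. Qed.

Lemma sqr_enorm m (u : 'cV[R]_m) : enorm u ^+ 2 = dotcv u u.
Proof. by rewrite sqr_sqrtr ?dotcv_ge0. Qed.

Lemma enorm_eq0 m (u : 'cV[R]_m) : enorm u = 0 -> u = 0.
Proof. by move=> u0; apply: dotcv_eq0; rewrite -sqr_enorm u0 expr0n. Qed.

Lemma enorm0 m : enorm (0 : 'cV[R]_m) = 0.
Proof. by rewrite /enorm dotcvE mulmx0 mxE sqrtr0. Qed.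

Lemma enormZ m a (u : 'cV[R]_m) : enorm (a *: u) = `|a| * enorm u.
Proof.
rewrite /enorm dotcvZr dotcvC dotcvZr mulrA -expr2 sqrtrM ?sqr_ge0//.
by rewrite sqrtr_sqr.
Qed.

Lemma enormN m (u : 'cV[R]_m) : enorm (- u) = enorm u.
Proof. by rewrite -scaleN1r enormZ normrN1 mul1r. Qed.

(** Cauchy-Schwarz: for [v] nonzero, the squared norm of [<v,v> u - <u,v> v] equals
    [<v,v> (<u,u><v,v> - <u,v>^2)], and the factor [<v,v>] is positive. *)
Lemma sqr_dotcv_le m (u v : 'cV[R]_m) :
  dotcv u v ^+ 2 <= dotcv u u * dotcv v v.
Proof.
have := dotcv_ge0 v; rewrite le_eqVlt => /orP[/eqP v0|v_gt0].
  by rewrite (dotcv_eq0 (esym v0)) dotcvE mulmx0 mxE expr0n mulr_ge0 ?dotcv_ge0.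
have := dotcv_ge0 (dotcv v v *: u - dotcv u v *: v).
rewrite dotcvBr !dotcvZr 2![dotcv (_ - _) _]dotcvC !dotcvBr !dotcvZr.
rewrite (dotcvC v u) => h; rewrite -subr_ge0 -(pmulr_rge0 _ v_gt0).
by apply: le_trans h _; rewrite le_eqVlt; apply/orP; left; apply/eqP; ring.
Qed.

Lemma dotcv_le_enorm m (u v : 'cV[R]_m) : dotcv u v <= enorm u * enorm v.
Proof.
rewrite (le_trans (ler_norm _))// -ler_sqr ?nnegrE ?mulr_ge0 ?enorm_ge0//.
by rewrite exprMn !sqr_enorm real_normK ?num_real ?sqr_dotcv_le.
Qed.

Lemma enormD m (u v : 'cV[R]_m) : enorm (u + v) <= enorm u + enorm v.
Proof.
rewrite -ler_sqr ?nnegrE ?addr_ge0 ?enorm_ge0// sqr_enorm dotcvDr.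
rewrite 2![dotcv (u + v) _]dotcvC !dotcvDr (dotcvC v u) -!sqr_enorm.
have := dotcv_le_enorm u v; lra.
Qed.

(** Since [sup] takes a default value on empty or unbounded sets, this is what makes [specnorm A] a
    genuine least upper bound. *)
Lemma has_sup_specnorm m p (A : 'M[R]_(m, p)) :
  has_sup [set enorm (A *m v) | v in [set v : 'cV[R]_p | enorm v <= 1]]%classic.
Proof.
split; first by exists (enorm (A *m 0)), 0; rewrite //= enorm0 ler01.
(* The witness is the Frobenius norm; Cauchy-Schwarz is applied row by row. *)
exists (Num.sqrt (\sum_i dotcv (row i A)^T (row i A)^T)) => _ [v /= v1 <-].
apply: ler_wsqrtr; apply: ler_sum => i _.
have -> : (A *m v) i 0 = dotcv (row i A)^T v.
  by rewrite dotcvE trmxK -row_mul [RHS]mxE.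
rewrite -expr2 (le_trans (sqr_dotcv_le _ _))// -[leRHS]mulr1.
by rewrite ler_wpM2l ?dotcv_ge0// -sqr_enorm exprn_ile1 ?enorm_ge0.
Qed.

Lemma enorm_mulmx_le m p (A : 'M[R]_(m, p)) v :
  enorm (A *m v) <= specnorm A * enorm v.
Proof.
have [/enorm_eq0 ->|v0] := eqVneq (enorm v) 0.
  by rewrite mulmx0 !enorm0 mulr0.
have v_gt0 : 0 < enorm v by rewrite lt_neqAle eq_sym v0 enorm_ge0.
rewrite -ler_pdivrMr//; apply: sup_upper_bound (has_sup_specnorm A) _ _.
exists ((enorm v)^-1 *: v) => /=; last rewrite -scalemxAr.
all: by rewrite enormZ ger0_norm ?invr_ge0 ?enorm_ge0// ?mulVf// mulrC.
Qed.

Lemma specnorm_ge0 m p (A : 'M[R]_(m, p)) : 0 <= specnorm A.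
Proof.
apply: (@le_trans _ _ (enorm (A *m 0))); first exact: enorm_ge0.
apply: sup_upper_bound (has_sup_specnorm A) _ _.
by exists 0 => //=; rewrite enorm0 ler01.
Qed.

(** [kermx] is a left kernel, so the argument passes to [A^T]: each row of its kernel, transposed,
    is a column killed by [A]. *)
Lemma unitmx_inj m (A : 'M[R]_m) :
  (forall u : 'cV_m, A *m u = 0 -> u = 0) -> A \in unitmx.
Proof.
move=> Ainj; rewrite -unitmx_tr -row_free_unit -kermx_eq0.
apply/eqP/row_matrixP => i; rewrite row0; apply: trmx_inj.
rewrite trmx0; apply: Ainj.
by rewrite -[LHS]trmxK trmx_mul trmxK -row_mul mulmx_ker row0 trmx0.
Qed.

End EuclideanNorm.

(** * Directional derivatives and the Taylor remainder of the gradient *)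

Section SecondOrder.
Context {R : realType} {N : nat}.
Implicit Types (f F : 'cV[R]_N -> R) (x v w : 'cV[R]_N).

Lemma derive_colE F x v : differentiable F x ->
  'D_v F x = \sum_j v j 0 * 'D_(delta_mx j 0 : 'cV[R]_N) F x.
Proof.
move=> dF; rewrite deriveE// [X in 'd F x X]matrix_sum_delta linear_sum/=.
apply: eq_bigr => j _.
by rewrite big_ord1 linearZ/= deriveE.
Qed.

(** The difference quotients of the one-variable map and of [F] in direction [v] coincide, which
    reduces multivariate questions to calculus on the real line. *)
Lemma is_derive_line F x v (t : R) : differentiable F (x + t *: v) ->
  is_derive t (1 : R) (fun s => F (x + s *: v)) ('D_v F (x + t *: v)).
Proof.
move=> dF.
have E :
    (fun h : R =>
       h^-1 *: (F (x + (h *: (1 : R) + t) *: v) - F (x + t *: v)))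
  = (fun h => h^-1 *: (F (h *: v + (x + t *: v)) - F (x + t *: v))).
  apply/funext => h; congr (_ *: (F _ - _)).
  by rewrite [h *: 1]mulr1 scalerDl addrCA.
have dv : derivable F (x + t *: v) v := diff_derivable dF.
split; first by rewrite /derivable E.
by rewrite /derive E.
Qed.

(** Pairing with a fixed [w] gives a scalar function, to which the mean value theorem applies; it is
    a linear combination of the gradient's coordinates. *)
Lemma derive_dotcv_gradient f x v w : differentiable (gradient f) x ->
  differentiable (fun y => dotcv w (gradient f y)) x /\
  'D_v (fun y => dotcv w (gradient f y)) x = dotcv w (hessian f x *m v).
Proof.
move=> dg.
have dgi i : differentiable (fun y => gradient f y i 0) x.
  exact: (differentiable_comp dg (differentiable_coord _ i 0)).
have E : (fun y => dotcv w (gradient f y)) =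
    \sum_i (w i 0 *: (fun y => gradient f y i 0 : R)).
  by apply/funext => y; rewrite fct_sumE.
split.
  by rewrite E; apply: differentiable_sum => i; apply: differentiableZ.
rewrite E derive_sum; last first.
  by move=> i; apply: derivableZ; exact: diff_derivable.
apply: eq_bigr => i _; rewrite deriveZ; last exact: diff_derivable.
congr (_ * _); rewrite derive_colE// mxE.
by apply: eq_bigr => j _; rewrite mxE mulrC.
Qed.

Lemma gradient_minimizer f x :
  (forall y, differentiable f y) ->
  minimizer f x -> gradient f x = 0.
Proof.
move=> df xmin; apply/matrixP => i j; rewrite ord1 !mxE.
set d := delta_mx i 0.
have D t := @is_derive_line f x d t (df _).
(* Fermat's rule on a coordinate line; any open interval around 0 would serve. *)
have D0 : is_derive (0 : R) (1 : R) (fun s => f (x + s *: d)) 0.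
  apply: (@derive1_at_min _ _ (-1) 1).
  - lra.
  - by move=> t _; case: (D t).
  - by rewrite in_itv/=; lra.
  - by move=> t _; rewrite scale0r addr0.
have := D 0; rewrite scale0r addr0 => -[_ <-].
by case: D0.
Qed.

Lemma gradient_taylor_le f (M : R) x v : twice_differentiable f ->
  (forall y z, specnorm (hessian f y - hessian f z) <= M * enorm (y - z)) ->
  enorm (gradient f (x + v) - gradient f x - hessian f x *m v)
    <= M / 2 * enorm v ^+ 2.
Proof.
move=> [_ dg] Hlip.
set w := (X in enorm X).
pose K := M / 2 * enorm v ^+ 2 * enorm w.
suff wK : dotcv w w <= K.
  have := enorm_ge0 w; rewrite le_eqVlt => /orP[/eqP <-|w_gt0].
    (* For [w = 0] the right-hand side must be nonnegative; the Lipschitz bound itself yields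
       [0 <= M * enorm v]. *)
    have := le_trans (specnorm_ge0 _) (Hlip (x + v) x).
    rewrite addrC addKr => Mv.
    by rewrite expr2 mulrA mulr_ge0 ?enorm_ge0// mulrAC divr_ge0.
  by rewrite -(ler_pM2r w_gt0) -expr2 (sqr_enorm w).
pose a := dotcv w (hessian f x *m v).
(* The increment of [psi] over [0, 1] is [dotcv w w - K]. The term [K t^2] is chosen because its
   derivative [2 K t = M t |v|^2 |w|] is the Lipschitz bound on the rest of [dpsi t], so [dpsi] is
   nonpositive on [0, 1]. *)
pose psi : R -> R :=
  (fun t => dotcv w (gradient f (x + t *: v))) - a *: id - K *: (id ^+ 2).
pose dpsi t : R := dotcv w (hessian f (x + t *: v) *m v) - a - 2 * K * t.
have Dpsi (t : R) : is_derive t (1 : R) psi (dpsi t).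
  have [dw Dw] := derive_dotcv_gradient v w (dg (x + t *: v)).
  have := is_derive_line dw; rewrite Dw => D1.
  rewrite /psi; apply: is_derive_eq; rewrite /dpsi /GRing.scale/=; ring.
have [|c] := @MVT_segment _ psi dpsi 0 1 ler01.
  apply: continuous_subspaceT => t.
  by apply/differentiable_continuous/derivable1_diffP; case: (Dpsi t).
rewrite in_itv/= => /andP[c_ge0 _].
have -> : psi 1 - psi 0 = dotcv w w - K.
  have psiE t : psi t = dotcv w (gradient f (x + t *: v)) - a * t - K * t ^+ 2.
    by [].
  rewrite {2}/w !dotcvBr !psiE /a scale1r scale0r addr0.
  ring.
rewrite subr0 mulr1 => psi_diff.
rewrite -subr_le0 psi_diff /dpsi /a -dotcvBr -mulmxBl subr_le0.
have /le_trans : dotcv w ((hessian f (x + c *: v) - hessian f x) *m v)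
    <= enorm w * (M * (c * enorm v) * enorm v).
  rewrite (le_trans (dotcv_le_enorm _ _))// ler_wpM2l ?enorm_ge0//.
  rewrite (le_trans (enorm_mulmx_le _ _))// ler_wpM2r ?enorm_ge0//.
  by rewrite (le_trans (Hlip _ _))// addrC addKr enormZ ger0_norm.
by apply; rewrite le_eqVlt /K; apply/orP; left; apply/eqP; field.
Qed.

End SecondOrder.


(** * Coercivity of the coarse Hessian and the coarse correction *)

Section CoarseStep.
Context {R : realType} {N n : nat}.
Variables (P : 'M[R]_(N, n)) (H : 'M[R]_N) (mu : R).
Hypotheses (rank_P : \rank P = n) (mu_gt0 : 0 < mu).
Hypothesis H_ge : loewner_le mu%:M H.

Local Notation A := (P^T *m H *m P).
Local Notation xi := (specnorm (coarse_pinv P P^T)).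

Lemma mulmx_full_rank_inj (u : 'cV[R]_n) : P *m u = 0 -> u = 0.
Proof.
move=> Pu0; have Pfree : row_free P^T by rewrite /row_free mxrank_tr rank_P.
apply: trmx_inj; apply: (row_free_inj Pfree).
by rewrite -trmx_mul Pu0 !trmx0 mul0mx.
Qed.

(** If [P^T P u = 0] then [|P u|^2 = <u, P^T P u> = 0]. Hence [coarse_pinv P P^T] is a true left
    inverse of [P]. *)
Lemma gram_unitmx : P^T *m P \in unitmx.
Proof.
apply: unitmx_inj => u PPu; apply/mulmx_full_rank_inj/dotcv_eq0.
by rewrite dotcv_trmx mulmxA PPu dotcvC dotcvE mulmx0 mxE.
Qed.

Lemma enorm_le_coarse_pinv (u : 'cV[R]_n) : enorm u <= xi * enorm (P *m u).
Proof.
rewrite -[u in leLHS](mulKmx gram_unitmx) -!mulmxA mulmxA.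
exact: enorm_mulmx_le.
Qed.

Lemma coarse_hessian_ge (u : 'cV[R]_n) :
  mu * enorm u ^+ 2 <= xi ^+ 2 * dotcv u (A *m u).
Proof.
have : 0 <= dotcv (P *m u) ((H - mu%:M) *m (P *m u)) := H_ge _.
rewrite mulmxBl dotcvBr mul_scalar_mx dotcvZr -sqr_enorm subr_ge0 => HP.
have -> : dotcv u (A *m u) = dotcv (P *m u) (H *m (P *m u)).
  by rewrite -!mulmxA dotcv_trmx trmxK.
apply: le_trans (ler_wpM2l (sqr_ge0 _) HP).
rewrite [leRHS]mulrCA ler_pM2l// -exprMn ler_sqr ?nnegrE ?enorm_ge0//.
  exact: enorm_le_coarse_pinv.
by rewrite mulr_ge0 ?specnorm_ge0 ?enorm_ge0.
Qed.

Lemma coarse_hessian_unitmx : A \in unitmx.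
Proof.
apply: unitmx_inj => u Au0; apply: enorm_eq0; apply/eqP.
have := coarse_hessian_ge u; rewrite Au0 dotcvE mulmx0 mxE mulr0.
by rewrite pmulr_rle0// -sqrf_eq0 eq_le sqr_ge0 andbT.
Qed.

Lemma enorm_coarse_correction_le (w : 'cV[R]_N) :
  enorm (P *m invmx A *m P^T *m w)
    <= specnorm P * specnorm P^T * xi ^+ 2 / mu * enorm w.
Proof.
rewrite -(mulmxA _ P^T) -(mulmxA P); set u := invmx _ *m _.
rewrite (le_trans (enorm_mulmx_le _ _))// -!mulrA ler_wpM2l ?specnorm_ge0//.
(* With [A u = P^T w], coercivity and Cauchy-Schwarz bound [mu |u|^2] by [xi^2 |u| |P^T w|]; one
   factor [|u|] is then cancelled. *)
suff : mu * enorm u <= xi ^+ 2 * (specnorm P^T * enorm w).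
  rewrite mulrC -ler_pdivlMr// => /le_trans -> //.
  by rewrite le_eqVlt; apply/orP; left; apply/eqP; ring.
have := enorm_ge0 u; rewrite le_eqVlt => /orP[/eqP <-|u_gt0].
  by rewrite mulr0 !mulr_ge0 ?sqr_ge0 ?specnorm_ge0 ?enorm_ge0.
rewrite -(ler_pM2r u_gt0) -mulrA -expr2.
have := coarse_hessian_ge u.
rewrite {3}/u (mulKVmx coarse_hessian_unitmx) => /le_trans -> //.
rewrite -[leRHS]mulrA ler_wpM2l ?sqr_ge0//.
rewrite (le_trans (dotcv_le_enorm _ _))// mulrC.
by rewrite ler_wpM2r ?enorm_ge0// enorm_mulmx_le.
Qed.

(* [1 - P A^-1 P^T H] annihilates [P], hence the vector [P P^T e]. *)
Lemma coarse_projection_mulmx (e : 'cV[R]_N) :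
  (1%:M - P *m invmx A *m P^T *m H) *m e =
  (1%:M - P *m invmx A *m P^T *m H) *m ((1%:M - P *m P^T) *m e).
Proof.
rewrite mulmxA; congr (_ *m e); rewrite mulmxBr mulmx1.
rewrite mulmxA mulmxBl mul1mx.
suff -> : P *m invmx A *m P^T *m H *m P = P by rewrite subrr mul0mx subr0.
by rewrite -!(mulmxA _ P^T) -(mulmxA _ _ P) mulmxKV ?coarse_hessian_unitmx.
Qed.

End CoarseStep.

Theorem theorem3p10 (R : realType) (N n : nat)
  (f : 'cV[R]_N -> R) (mu L M : R)
  (mu_gt0 : 0 < mu) (L_gt0 : 0 < L) (M_gt0 : 0 < M)
  (f_diff2 : twice_differentiable f)
  (f_hess_ge : forall x : 'cV[R]_N, loewner_le mu%:M (hessian f x))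
  (f_hess_le : forall x : 'cV[R]_N, loewner_le (hessian f x) L%:M)
  (f_hess_lip : forall x y : 'cV[R]_N,
     specnorm (hessian f x - hessian f y) <= M * enorm (x - y))
  (le_nN : (n <= N)%N)
  (P : 'M[R]_(N, n)) (rank_P : \rank P = n)
  (Rs : 'M[R]_(n, N)) (RsE : Rs = P^T)
  (omega : R) (omegaE : omega = Num.max (specnorm P) (specnorm Rs))
  (xi : R) (xiE : xi = specnorm (coarse_pinv P Rs))
  (kappa eps rho1 beta : R)
  (kappa_bounds : 0 < kappa < Num.min 1 (specnorm Rs))
  (eps_bounds : 0 < eps < 1)
  (rho1_bounds : 0 < rho1 < 2^-1)
  (beta_bounds : 0 < beta < 1)
  (x d : nat -> 'cV[R]_N) (alpha : nat -> R)
  (x_run : nemo_run f P Rs kappa eps rho1 beta x d alpha)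
  (k : nat)
  (k_coarse : coarse_condition f Rs kappa eps (x k))
  (k_unit_step : alpha k = 1)
  (xstar : 'cV[R]_N) (xstar_min : minimizer f xstar) :
  enorm (x k.+1 - xstar) <=
    specnorm (1%:M - P *m invmx (Rs *m hessian f (x k) *m P)
                       *m Rs *m hessian f (x k))
      * enorm ((1%:M - P *m Rs) *m (x k - xstar))
    + (M * omega ^+ 2 * xi ^+ 2) / (2 * mu) * enorm (x k - xstar) ^+ 2.
Proof.
have [dir _ ->] := x_run k.
(* [k_coarse] rules out the fine branch. *)
have {dir} -> : d k = coarse_step f P Rs (x k) by case: dir => -[].
rewrite k_unit_step scale1r; subst Rs.
set e := x k - xstar; set H := hessian f (x k).
have g0 : gradient f xstar = 0 := gradient_minimizer f_diff2.1 xstar_min.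
pose C := P *m invmx (P^T *m H *m P) *m P^T.
(* The expansion is centred at [x k], where [H] is taken, with displacement [- e] leading to
   [xstar]; as the gradient vanishes there, [r] is [H e - g]. *)
pose r := gradient f (x k + - e) - gradient f (x k) - H *m (- e).
have -> : x k + coarse_step f P P^T (x k) - xstar
    = (1%:M - C *m H) *m ((1%:M - P *m P^T) *m e) + C *m r.
  rewrite -(coarse_projection_mulmx rank_P mu_gt0 (f_hess_ge _)).
  have xe : x k + - e = xstar by rewrite /e opprB addrC subrK.
  have -> : r = H *m e - gradient f (x k).
    by rewrite /r xe g0 sub0r mulmxN opprK addrC.
  by rewrite mulmxBl mul1mx (mulmxBr C) (mulmxA C) addrA subrK /e [RHS]addrAC.
rewrite (le_trans (enormD _ _))// lerD ?enorm_mulmx_le//.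
rewrite (le_trans (enorm_coarse_correction_le rank_P mu_gt0 (f_hess_ge _) _))//.
have := gradient_taylor_le (x k) (- e) f_diff2 f_hess_lip.
rewrite enormN => r_le.
(* [omega] dominates both norms, so their equality is never invoked. *)
have PPo : specnorm P * specnorm P^T <= omega ^+ 2.
  by rewrite expr2 omegaE ler_pM ?specnorm_ge0// le_max lexx ?orbT.
rewrite -xiE.
have -> : M * omega ^+ 2 * xi ^+ 2 / (2 * mu) * enorm e ^+ 2
    = omega ^+ 2 * xi ^+ 2 / mu * (M / 2 * enorm e ^+ 2).
  by field; rewrite lt0r_neq0.
have xi_mu : 0 <= xi ^+ 2 / mu by rewrite divr_ge0 ?sqr_ge0 ?ltW.
rewrite -!(mulrA _ (xi ^+ 2) mu^-1).
by rewrite ler_pM ?(ler_wpM2r xi_mu) ?enorm_ge0 ?(mulr_ge0 _ xi_mu) ?mulr_ge0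
  ?specnorm_ge0.
Qed.
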